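(* Assume $-y\ge r/(4c)$. Then the function $g$ defined in the context is a viscosity solution on $[0,D]$ (in the sense defined in the context) of the Bellman equation $$\max\Big\{-\frac{1}{4c}(f'(x))^2-y f'(x)-h(x),\ f'(x)-r\Big\}=0 .$$
   Context: Fixed data: constants $D>0$, $r>0$, $c>0$, $y\in\mathbb{R}$ and a continuous, strictly increasing function $h:[0,D]\to[0,\infty)$ with $h(0)=0$. Under $-y\ge r/(4c)$ define $$\beta_0=\begin{cases}h^{-1}\big(-\tfrac{r^2}{4c}-ry\big), & -h(D)\le \tfrac{r^2}{4c}+ry\le 0,\\ D, & \tfrac{r^2}{4c}+ry<-h(D),\end{cases}$$ and $g:[0,D]\to\mathbb{R}$ by $$g(x)=\int_0^x2c\Big(-y-\sqrt{y^2-h(u)/c}\Big)du\ \ (0\le x\le\beta_0),\qquad g(x)=g(\beta_0)+r(x-\beta_0)\ \ (\beta_0<x\le D).$$ (One has $y^2-h(u)/c\ge0$ for $u\in[0,\beta_0]$.) Viscosity solutions. For $B=(0,D)$ or $B=(0,D]$, a continuous function $f:[0,D]\to\mathbb{R}$ is a viscosity supersolution (resp. subsolution) of the Bellman equation on $B$ if for every $x\in B$ and every $\phi\in C^1([0,D],\mathbb{R})$ for which $f-\phi$ has a global minimum (resp. maximum) on $B$ at $x$, one has $\max\{-\frac1{4c}(\phi'(x))^2-y\phi'(x)-h(x),\ \phi'(x)-r\}\ge0$ (resp. $\le0$). A function $f:[0,D]\to\mathbb{R}$ is a viscosity solution on $[0,D]$ if it is a viscosity subsolution on $(0,D)$, a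 viscosity supersolution on $(0,D]$, and $f(0)=0$. *)

(* Defs.v *)
From Stdlib Require Export Reals.
From Stdlib Require Import ClassicalEpsilon.
From Coquelicot Require Import Coquelicot.
Open Scope R_scope.

(* Functions on [0,D] are total functions R -> R of which only the values
   on [0,D] matter. *)
Definition Icc (a b : R) : R -> Prop := fun x => a <= x <= b.
Definition Ioo (a b : R) : R -> Prop := fun x => a < x < b.
Definition Ioc (a b : R) : R -> Prop := fun x => a < x <= b.

(* Relative to the subset A: one-sided at the endpoints of an interval. *)
Definition cont_on (A : R -> Prop) (f : R -> R) : Prop :=
  forall x, A x -> continue_in f A x.

Definition strictly_increasing_on (A : R -> Prop) (f : R -> R) : Prop :=
  forall x z, A x -> A z -> x < z -> f x < f z.

(* phi is of class C^1 on A with derivative dphi; derivatives and continuity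
   are taken relative to A, hence one-sided at the endpoints of [0,D]. *)
Definition C1_on (A : R -> Prop) (phi dphi : R -> R) : Prop :=
  (forall x, A x -> D_in phi dphi A x) /\ cont_on A dphi.

(* The inverse of h : A -> h(A); arbitrary outside h(A). *)
Definition inverse_on (A : R -> Prop) (h : R -> R) (v : R) : R :=
  epsilon (inhabits 0) (fun x => A x /\ h x = v).

(* When -y >= r/(4c), the quantity r^2/(4c) + r y is nonpositive, so the test
   below separates exactly the two cases of the definition of beta_0. *)
Definition beta0 (D r c y : R) (h : R -> R) : R :=
  if Rle_dec (- h D) (r ^ 2 / (4 * c) + r * y)
  then inverse_on (Icc 0 D) h (- (r ^ 2 / (4 * c)) - r * y)
  else D.

Definition g (D r c y : R) (h : R -> R) (x : R) : R :=
  let b := beta0 D r c y h in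
  let G := fun z => RInt (fun u => 2 * c * (- y - sqrt (y ^ 2 - h u / c))) 0 z in
  if Rle_dec x b then G x else G b + r * (x - b).

(* Left-hand side of the Bellman equation at x, with f'(x) replaced by p. *)
Definition bellman (r c y : R) (h : R -> R) (x p : R) : R :=
  Rmax (- (1 / (4 * c)) * p ^ 2 - y * p - h x) (p - r).

Definition viscosity_supersolution (D r c y : R) (h : R -> R)
    (B : R -> Prop) (f : R -> R) : Prop :=
  cont_on (Icc 0 D) f /\
  forall (x : R) (phi dphi : R -> R),
    B x -> C1_on (Icc 0 D) phi dphi ->
    (forall z, B z -> f x - phi x <= f z - phi z) ->
    bellman r c y h x (dphi x) >= 0.

Definition viscosity_subsolution (D r c y : R) (h : R -> R)
    (B : R -> Prop) (f : R -> R) : Prop :=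
  cont_on (Icc 0 D) f /\
  forall (x : R) (phi dphi : R -> R),
    B x -> C1_on (Icc 0 D) phi dphi ->
    (forall z, B z -> f z - phi z <= f x - phi x) ->
    bellman r c y h x (dphi x) <= 0.

Definition viscosity_solution (D r c y : R) (h : R -> R) (f : R -> R) : Prop :=
  viscosity_subsolution D r c y h (Ioo 0 D) f /\
  viscosity_supersolution D r c y h (Ioc 0 D) f /\
  f 0 = 0.

(* Main.v *)
Require Import Defs.
From Stdlib Require Import Reals.
From Stdlib Require Import ClassicalEpsilon Lra.
From Coquelicot Require Import Coquelicot.
Open Scope R_scope.

(** Left of [beta0] the slope of [g] is the smaller root of the concave
    quadratic [p |-> - p^2/(4c) - y p - h x], and [r] lies between its two
    roots; right of [beta0] the slope is [r] and the quadratic is nonpositive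
    at [r]. A test function touching [g] from below at [x] has slope at least
    the left slope of [g], hence its slope either lies between the two roots
    or exceeds [r], including at the possible kink [beta0] and at [D]. One
    touching [g] from above has slope at most the left slope, which settles
    [x <= beta0]; beyond [beta0] its slope is exactly [r]. *)

(** * One-sided derivatives at a point of contact *)

Lemma limit1_in_le0 (F : R -> R) (A : R -> Prop) (l x : R) :
  limit1_in F A l x -> adhDa A x -> (forall z, A z -> F z <= 0) -> l <= 0.
Proof.
  intros HF Hadh Hneg. apply Rnot_lt_le. intros Hl.
  destruct (HF l Hl) as [alp [Halp Hlim]].
  destruct (Hadh alp Halp) as [z [Az Hz]].
  specialize (Hlim z (conj Az Hz)). specialize (Hneg z Az).
  simpl in Hlim. unfold Rdist in Hlim. apply Rabs_def2 in Hlim. lra.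
Qed.

Lemma D_in_subset (A B : R -> Prop) (f d : R -> R) (x : R) :
  (forall z, A z -> B z) -> D_in f d B x -> D_in f d A x.
Proof.
  intros HAB Hf eps Heps. destruct (Hf eps Heps) as [alp [Halp Hlim]].
  exists alp. split; [exact Halp|].
  intros z [[Az Hne] Hz]. apply Hlim. split; [split; auto|exact Hz].
Qed.

Lemma D_in_ext (A : R -> Prop) (f F d : R -> R) (x : R) :
  (forall z, A z -> f z = F z) -> A x -> D_in F d A x -> D_in f d A x.
Proof.
  intros Hext Ax HF eps Heps. destruct (HF eps Heps) as [alp [Halp Hlim]].
  exists alp. split; [exact Halp|].
  intros z [[Az Hne] Hz]. rewrite (Hext z Az), (Hext x Ax).
  apply Hlim. split; [split; auto|exact Hz].
Qed.

Lemma is_derive_D_in (A : R -> Prop) (F d : R -> R) (x : R) :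
  is_derive F x (d x) -> D_in F d A x.
Proof.
  intros HF. apply is_derive_Reals in HF.
  apply (D_in_subset A no_cond); [now intros|].
  now apply derivable_pt_lim_D_in.
Qed.

(** At a minimum approached from the left, every difference quotient is nonpositive. Being
    one-sided, this also covers the kink and the endpoint [D]. *)
Lemma D_in_min_left (w d : R -> R) (a x : R) :
  a < x -> D_in w d (Ioc a x) x -> (forall z, Ioc a x z -> w x <= w z) ->
  d x <= 0.
Proof.
  intros Hax Hw Hmin.
  apply (limit1_in_le0 _ _ _ _ Hw).
  (* The limit is informative only if [x] is adherent to the rest of the interval; the two halves
     put the witness within [alp] of [x] and to the right of [a]. *)
  - intros alp Halp. exists (x - Rmin (alp / 2) ((x - a) / 2)).
    assert (0 < Rmin (alp / 2) ((x - a) / 2)) by (apply Rmin_glb_lt; lra).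
    pose proof (Rmin_l (alp / 2) ((x - a) / 2)).
    pose proof (Rmin_r (alp / 2) ((x - a) / 2)).
    unfold D_x, Ioc, Rdist. split; [lra|].
    apply Rabs_def1; lra.
  - intros z [Az Hne]. specialize (Hmin z Az). unfold Ioc in Az.
    replace ((w z - w x) / (z - x)) with (- ((w z - w x) / (x - z)))
      by (field; lra).
    enough (0 <= (w z - w x) / (x - z)) by lra.
    apply Rdiv_le_0_compat; lra.
Qed.

Lemma D_in_max_right (w d : R -> R) (x b : R) :
  x < b -> D_in w d (fun z => x <= z < b) x ->
  (forall z, x <= z < b -> w z <= w x) -> d x <= 0.
Proof.
  intros Hxb Hw Hmax.
  apply (limit1_in_le0 _ _ _ _ Hw).
  - intros alp Halp. exists (x + Rmin (alp / 2) ((b - x) / 2)).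
    assert (0 < Rmin (alp / 2) ((b - x) / 2)) by (apply Rmin_glb_lt; lra).
    pose proof (Rmin_l (alp / 2) ((b - x) / 2)).
    pose proof (Rmin_r (alp / 2) ((b - x) / 2)).
    unfold D_x, Rdist. split; [lra|].
    apply Rabs_def1; lra.
  - intros z [Az Hne]. specialize (Hmax z Az).
    replace ((w z - w x) / (z - x)) with (- ((w x - w z) / (z - x)))
      by (field; lra).
    enough (0 <= (w x - w z) / (z - x)) by lra.
    apply Rdiv_le_0_compat; lra.
Qed.

Lemma touch_below_left (f phi df dphi : R -> R) (a x : R) :
  a < x -> D_in f df (Ioc a x) x -> D_in phi dphi (Ioc a x) x ->
  (forall z, Ioc a x z -> f x - phi x <= f z - phi z) ->
  df x <= dphi x.
Proof.
  intros Hax Hf Hphi Hmin.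
  pose proof (D_in_min_left _ _ a x Hax (Dminus _ _ _ _ _ _ Hf Hphi) Hmin).
  simpl in H. lra.
Qed.

Lemma touch_above_left (f phi df dphi : R -> R) (a x : R) :
  a < x -> D_in f df (Ioc a x) x -> D_in phi dphi (Ioc a x) x ->
  (forall z, Ioc a x z -> f z - phi z <= f x - phi x) ->
  dphi x <= df x.
Proof.
  intros Hax Hf Hphi Hmax.
  apply (touch_below_left phi f dphi df a x Hax Hphi Hf).
  intros z Hz. specialize (Hmax z Hz). lra.
Qed.

Lemma touch_above_right (f phi df dphi : R -> R) (x b : R) :
  x < b -> D_in f df (fun z => x <= z < b) x ->
  D_in phi dphi (fun z => x <= z < b) x ->
  (forall z, x <= z < b -> f z - phi z <= f x - phi x) ->
  df x <= dphi x.
Proof.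
  intros Hxb Hf Hphi Hmax.
  pose proof (D_in_max_right _ _ x b Hxb (Dminus _ _ _ _ _ _ Hf Hphi) Hmax).
  simpl in H. lra.
Qed.

(** * Extension from an interval to the line, and continuity *)

(** Composing with this projection onto [[a,b]] turns relative continuity into continuity on all of
    R, as the intermediate value theorem and the integral calculus below require. *)
Definition clamp (a b x : R) : R := Rmax a (Rmin x b).

Lemma clamp_in (a b x : R) : a <= b -> Icc a b (clamp a b x).
Proof.
  intros Hab. unfold Icc, clamp, Rmax, Rmin.
  repeat destruct Rle_dec; lra.
Qed.

Lemma clamp_id (a b x : R) : Icc a b x -> clamp a b x = x.
Proof.
  unfold Icc, clamp, Rmax, Rmin. repeat destruct Rle_dec; lra.
Qed.

Lemma clamp_lipschitz (a b x z : R) :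
  a <= b -> Rabs (clamp a b x - clamp a b z) <= Rabs (x - z).
Proof.
  intros Hab. unfold clamp, Rmax, Rmin.
  repeat destruct Rle_dec; unfold Rabs; repeat destruct Rcase_abs; lra.
Qed.

Lemma continuous_clamp (a b : R) (f : R -> R) :
  a <= b -> cont_on (Icc a b) f -> forall x, continuous (fun u => f (clamp a b u)) x.
Proof.
  intros Hab Hf x. apply continuity_pt_filterlim. intros eps Heps.
  destruct (Hf _ (clamp_in a b x Hab) eps Heps) as [alp [Halp Hlim]].
  exists alp. split; [exact Halp|]. intros z [_ Hz].
  (* [continue_in] says nothing about the base point itself, so coinciding projections are treated
     apart. *)
  destruct (Req_dec (clamp a b x) (clamp a b z)) as [E|E].
  - simpl. unfold Rdist. rewrite E, Rminus_diag, Rabs_R0. exact Heps.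
  - apply Hlim. split; [split; [now apply clamp_in|exact E]|].
    eapply Rle_lt_trans; [now apply clamp_lipschitz|exact Hz].
Qed.

Lemma continuous_Rmin_l (b x : R) : continuous (fun z => Rmin z b) x.
Proof.
  apply continuity_pt_filterlim. intros eps Heps. exists eps. split; [exact Heps|].
  intros z [_ Hz]. simpl in *. unfold Rdist in *.
  eapply Rle_lt_trans; [|exact Hz].
  unfold Rmin; repeat destruct Rle_dec; unfold Rabs; repeat destruct Rcase_abs; lra.
Qed.

Lemma continuous_cont_on (A : R -> Prop) (f F : R -> R) :
  (forall z, A z -> f z = F z) -> (forall x, continuous F x) -> cont_on A f.
Proof.
  intros Hext HF x Ax eps Heps.
  pose proof (HF x) as Hx. apply continuity_pt_filterlim in Hx.
  destruct (Hx eps Heps) as [alp [Halp Hlim]].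
  exists alp. split; [exact Halp|]. intros z [[Az Hne] Hz].
  rewrite (Hext z Az), (Hext x Ax). apply Hlim. split; [split; [exact I|exact Hne]|exact Hz].
Qed.

(** * The quadratic and its roots *)

Definition slope (c y v : R) : R := 2 * c * (- y - sqrt (y ^ 2 - v / c)).

Lemma slope_factor (c y v p : R) :
  0 < c -> v <= c * y ^ 2 ->
  - (1 / (4 * c)) * p ^ 2 - y * p - v =
  (p - slope c y v) * (slope c y v + 4 * c * sqrt (y ^ 2 - v / c) - p) / (4 * c).
Proof.
  intros Hc Hv. unfold slope.
  assert (Hs : 0 <= y ^ 2 - v / c).
  { replace (y ^ 2 - v / c) with ((c * y ^ 2 - v) / c) by (field; lra).
    apply Rdiv_le_0_compat; lra. }
  pose proof (sqrt_sqrt _ Hs) as E. set (s := sqrt _) in *.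
  replace v with (c * (y ^ 2 - s * s)) by (rewrite E; field; lra).
  field; lra.
Qed.

(* If [v] is at most the value of the quadratic at [r], then [r] lies between
   the two solutions of [- p^2/(4c) - y p = v]. *)
Lemma slope_bounds (c y v r : R) :
  0 < c -> v <= - (r ^ 2 / (4 * c)) - r * y ->
  slope c y v <= r <= slope c y v + 4 * c * sqrt (y ^ 2 - v / c).
Proof.
  intros Hc Hv.
  (* Completing the square: the two sides differ by the value of the quadratic at [r] minus [v],
     divided by [c]. Taking roots bounds [y + r / (2 * c)] in absolute value, and its two signs give
     the two inequalities. *)
  assert (Hsq : (y + r / (2 * c))² <= y ^ 2 - v / c).
  { unfold Rsqr.
    enough (0 <= (- (r ^ 2 / (4 * c)) - r * y - v) / c) as H.
    { replace ((y + r / (2 * c)) * (y + r / (2 * c)))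
        with (y ^ 2 - v / c - (- (r ^ 2 / (4 * c)) - r * y - v) / c)
        by (field; lra). lra. }
    apply Rdiv_le_0_compat; lra. }
  apply sqrt_le_1_alt in Hsq. rewrite sqrt_Rsqr_abs in Hsq.
  pose proof (Rle_abs (y + r / (2 * c))) as H1.
  pose proof (Rle_abs (- (y + r / (2 * c)))) as H2. rewrite Rabs_Ropp in H2.
  unfold slope. set (s := sqrt _) in *.
  assert (Er : r = 2 * c * (r / (2 * c))) by (field; lra).
  set (q := r / (2 * c)) in *.
  rewrite Er. split; nra.
Qed.

(** The right side is the maximum of the concave quadratic, attained at [- 2 * c * y]. Hence the
    roots are real as soon as [v] is at most the value at [r]. *)
Lemma quadratic_le_vertex (c y r : R) :
  0 < c -> - (r ^ 2 / (4 * c)) - r * y <= c * y ^ 2.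
Proof.
  intros Hc.
  enough (0 <= c * (y + r / (2 * c)) ^ 2) as H.
  { replace (c * (y + r / (2 * c)) ^ 2)
      with (c * y ^ 2 - (- (r ^ 2 / (4 * c)) - r * y)) in H by (field; lra). lra. }
  apply Rmult_le_pos; [lra|apply pow2_ge_0].
Qed.

(** If [p >= r] the second term of the maximum suffices; otherwise [p] lies between the roots and
    both factors of the quadratic are nonnegative. *)
Lemma bellman_ge0 (r c y x p : R) (h : R -> R) :
  0 < c -> h x <= - (r ^ 2 / (4 * c)) - r * y -> slope c y (h x) <= p ->
  bellman r c y h x p >= 0.
Proof.
  intros Hc Hh Hp. apply Rle_ge. unfold bellman.
  destruct (Rle_dec r p) as [Hrp|Hrp].
  { eapply Rle_trans; [|apply Rmax_r]. lra. }
  eapply Rle_trans; [|apply Rmax_l].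
  pose proof (quadratic_le_vertex c y r Hc).
  pose proof (slope_bounds c y (h x) r Hc Hh).
  rewrite slope_factor by lra.
  apply Rdiv_le_0_compat; [|lra].
  apply Rmult_le_pos; lra.
Qed.

Lemma bellman_le0 (r c y x p : R) (h : R -> R) :
  0 < c -> h x <= - (r ^ 2 / (4 * c)) - r * y -> p <= slope c y (h x) ->
  bellman r c y h x p <= 0.
Proof.
  intros Hc Hh Hp. unfold bellman.
  pose proof (quadratic_le_vertex c y r Hc).
  pose proof (slope_bounds c y (h x) r Hc Hh).
  apply Rmax_lub; [|lra].
  rewrite slope_factor by lra.
  enough (0 <= (slope c y (h x) - p) *
    (slope c y (h x) + 4 * c * sqrt (y ^ 2 - h x / c) - p) / (4 * c)).
  { unfold Rdiv in *. lra. }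
  apply Rdiv_le_0_compat; [|lra].
  apply Rmult_le_pos; lra.
Qed.

(** * The threshold [beta0] *)

Lemma beta0_spec (D r c y : R) (h : R -> R) :
  D > 0 -> r > 0 -> c > 0 ->
  cont_on (Icc 0 D) h -> strictly_increasing_on (Icc 0 D) h ->
  h 0 = 0 -> - y >= r / (4 * c) ->
  Icc 0 D (beta0 D r c y h) /\
  (forall x, 0 <= x <= beta0 D r c y h -> h x <= - (r ^ 2 / (4 * c)) - r * y) /\
  (forall x, beta0 D r c y h < x <= D -> - (r ^ 2 / (4 * c)) - r * y <= h x).
Proof.
  intros HD Hr Hc Hcont Hinc H0 Hy.
  assert (Hmon : forall u v, 0 <= u -> u <= v -> v <= D -> h u <= h v).
  { intros u v Hu [Huv|<-] Hv; [|lra].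
    left. apply Hinc; unfold Icc; lra. }
  unfold beta0. set (q := - (r ^ 2 / (4 * c)) - r * y).
  (* This is where [- y >= r / (4 * c)] enters: it puts [q] above [h 0], the lower end needed for
     the intermediate value theorem. *)
  assert (Hq : 0 <= q).
  { unfold q. replace (r ^ 2 / (4 * c)) with (r * (r / (4 * c))) by (field; lra). nra. }
  destruct Rle_dec as [Hle|Hle].
  - assert (Hex : exists x, Icc 0 D x /\ h x = q).
    { destruct (IVT_gen (fun u => h (clamp 0 D u)) 0 D q) as [x [Hx Ex]].
      - intros u. apply continuity_pt_filterlim. apply continuous_clamp; [lra|exact Hcont].
      - rewrite !clamp_id by (unfold Icc; lra). rewrite H0.
        split; [eapply Rle_trans; [apply Rmin_l|lra]|].
        eapply Rle_trans; [|apply Rmax_r]. unfold q. lra.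
      - rewrite Rmin_left, Rmax_right in Hx by lra.
        exists x. rewrite clamp_id in Ex by exact Hx. now split. }
    unfold inverse_on.
    destruct (epsilon_spec (inhabits 0) _ Hex) as [Hb Eb].
    set (b := epsilon _ _) in *. unfold Icc in Hb.
    split; [exact Hb|]. rewrite <- Eb.
    split; intros x Hx; apply Hmon; lra.
  (* Here the threshold is [D], so nothing lies beyond it, and [h D < q] bounds [h] on the whole
     interval. *)
  - split; [unfold Icc; lra|]. split; intros x Hx; [|lra].
    apply Rle_trans with (h D); [apply Hmon; lra|unfold q; lra].
Qed.

Lemma continuous_slope_clamp (D c y : R) (h : R -> R) :
  0 <= D -> c > 0 -> cont_on (Icc 0 D) h ->
  forall u, continuous (fun u => slope c y (h (clamp 0 D u))) u.
Proof.
  intros HD Hc Hh u. unfold slope.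
  apply (continuous_scal_r (2 * c) (fun u => - y - sqrt (y ^ 2 - h (clamp 0 D u) / c))).
  apply (continuous_minus (fun _ => - y)); [apply continuous_const|].
  apply continuous_comp; [|apply continuous_sqrt].
  apply (continuous_minus (fun _ => y ^ 2)); [apply continuous_const|].
  unfold Rdiv.
  apply (continuous_scal_l (fun u => h (clamp 0 D u)) (/ c)).
  now apply continuous_clamp.
Qed.

(** * Verification of the viscosity inequalities for [g] *)

Theorem theorem3p2 :
  forall (D r c y : R) (h : R -> R),
    D > 0 -> r > 0 -> c > 0 ->
    cont_on (Icc 0 D) h ->
    strictly_increasing_on (Icc 0 D) h ->
    (forall x, Icc 0 D x -> 0 <= h x) ->
    h 0 = 0 ->
    - y >= r / (4 * c) ->
    viscosity_solution D r c y h (g D r c y h).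
Proof.
  intros D r c y h HD Hr Hc Hcont Hinc _ H0 Hy.
  destruct (beta0_spec D r c y h HD Hr Hc Hcont Hinc H0 Hy) as [Hb [Hlow Hhigh]].
  set (b := beta0 D r c y h) in *. unfold Icc in Hb.
  (* With [h] clamped, the integrand is continuous on R, so its primitive [G] is differentiable
     everywhere and agrees with the integral in [g] on [[0,D]]. *)
  set (K := fun u => slope c y (h (clamp 0 D u))).
  assert (HK : forall u, continuous K u)
    by (intros u; apply continuous_slope_clamp; [lra|exact Hc|exact Hcont]).
  set (G := (fun z => RInt K 0 z) : R -> R).
  assert (HG : forall z, is_derive G z (K z)).
  { intros z. apply (is_derive_RInt K G 0); [|apply HK].
    apply filter_forall. intros t. apply (@RInt_correct R_CompleteNormedModule).
    apply ex_RInt_continuous. intros; apply HK. }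
  assert (HGg : forall z, 0 <= z <= D ->
    RInt (fun u => 2 * c * (- y - sqrt (y ^ 2 - h u / c))) 0 z = G z).
  { intros z Hz. apply RInt_ext. rewrite Rmin_left, Rmax_right by lra.
    intros u Hu. unfold K. rewrite clamp_id by (unfold Icc; lra). reflexivity. }
  assert (Hgl : forall z, 0 <= z <= b -> g D r c y h z = G z).
  { intros z Hz. unfold g. fold b. destruct Rle_dec; [|lra]. apply HGg. lra. }
  assert (Hgr : forall z, b < z -> g D r c y h z = G b + r * (z - b)).
  { intros z Hz. unfold g. fold b. destruct Rle_dec; [lra|]. rewrite HGg by lra. reflexivity. }
  assert (Hgc : cont_on (Icc 0 D) (g D r c y h)).
  { apply continuous_cont_on with (fun z => G (Rmin z b) + r * (z - Rmin z b)).
    - intros z Hz. unfold Icc in Hz. destruct (Rle_lt_dec z b).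
      + rewrite Hgl, Rmin_left by lra. simpl. lra.
      + rewrite Hgr, Rmin_right by lra. reflexivity.
    - intros z.
      apply (continuous_plus (fun z => G (Rmin z b)) (fun z => r * (z - Rmin z b))).
      + apply continuous_comp; [apply continuous_Rmin_l|].
        apply (@ex_derive_continuous R_AbsRing R_NormedModule). eexists; apply HG.
      + apply (continuous_scal_r r (fun z => z - Rmin z b)).
        apply (continuous_minus (U := R_UniformSpace) (V := R_NormedModule) (fun z => z)); [apply continuous_id|apply continuous_Rmin_l]. }
  (* Only the left derivative is claimed, since at [x = b] the slope to the right may differ. *)
  assert (HDl : forall x, 0 < x <= b -> D_in (g D r c y h) K (Ioc 0 x) x).
  { intros x Hx. apply D_in_ext with G; [| unfold Ioc; lra |].
    - intros z Hz. unfold Ioc in Hz. apply Hgl. lra.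
    - apply is_derive_D_in, HG. }
  assert (HDr : forall A x, (forall z, A z -> b < z) -> A x ->
    D_in (g D r c y h) (fun _ => r) A x).
  { intros A x HA Ax. apply D_in_ext with (fun z => G b + r * (z - b)); [auto|exact Ax|].
    apply is_derive_D_in. auto_derive; [exact I|ring]. }
  assert (EK : forall x, 0 <= x <= D -> K x = slope c y (h x))
    by (intros x Hx; unfold K; now rewrite clamp_id).
  split; [|split].
  - split; [exact Hgc|]. intros x phi dphi Bx [Hphi _] Hmax. unfold Ioo in *.
    assert (Hphi' : D_in phi dphi (Icc 0 D) x) by (apply Hphi; unfold Icc; lra).
    destruct (Rle_lt_dec x b) as [Hxb|Hxb].
    + apply bellman_le0; [lra|apply Hlow; lra|]. rewrite <- EK by lra.
      apply touch_above_left with (g D r c y h) phi 0; [lra|apply HDl; lra| |].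
      * revert Hphi'. apply D_in_subset. unfold Ioc, Icc. intros; lra.
      * unfold Ioc. intros; apply Hmax; lra.
    (* Since [b < x < D], [g] is affine of slope [r] on both sides of [x]; contact from the right
       gives [r <= dphi x], contact from the left the converse. *)
    + replace (dphi x) with r.
      { unfold bellman. specialize (Hhigh x). apply Rmax_lub; [|lra].
        replace (- (1 / (4 * c)) * r ^ 2) with (- (r ^ 2 / (4 * c))) by (field; lra).
        lra. }
      apply Rle_antisym.
      * apply (touch_above_right (g D r c y h) phi (fun _ => r) dphi x D); [lra| | |].
        -- apply HDr; intros; lra.
        -- revert Hphi'. apply D_in_subset. unfold Icc. intros; lra.
        -- intros; apply Hmax; lra.
      * apply (touch_above_left (g D r c y h) phi (fun _ => r) dphi b x); [lra| | |].
        -- apply HDr; unfold Ioc; intros; lra.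
        -- revert Hphi'. apply D_in_subset. unfold Ioc, Icc. intros; lra.
        -- unfold Ioc. intros; apply Hmax; lra.
  - split; [exact Hgc|]. intros x phi dphi Bx [Hphi _] Hmin. unfold Ioc in Bx, Hmin.
    assert (Hphi' : D_in phi dphi (Icc 0 D) x) by (apply Hphi; unfold Icc; lra).
    destruct (Rle_lt_dec x b) as [Hxb|Hxb].
    + apply bellman_ge0; [lra|apply Hlow; lra|]. rewrite <- EK by lra.
      apply touch_below_left with (g D r c y h) phi 0; [lra|apply HDl; lra| |].
      * revert Hphi'. apply D_in_subset. unfold Ioc, Icc. intros; lra.
      * unfold Ioc. intros; apply Hmin; lra.
    (* The term [dphi x - r] alone settles this case; contact from the left is available even at
       [x = D]. *)
    + enough (r <= dphi x).
      { apply Rle_ge. unfold bellman. eapply Rle_trans; [|apply Rmax_r]. lra. }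
      apply (touch_below_left (g D r c y h) phi (fun _ => r) dphi b x); [lra| | |].
      * apply HDr; unfold Ioc; intros; lra.
      * revert Hphi'. apply D_in_subset. unfold Ioc, Icc. intros; lra.
      * unfold Ioc. intros; apply Hmin; lra.
  - rewrite Hgl by lra. apply (@RInt_point R_CompleteNormedModule).
Qed.
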